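(* For each $d$, let $\{X_{d,n}\}_{n=0}^\infty$ be a $d$-dimensional simple random walk starting at $0$, let $l_d=\{(n,n,\dots,n)\in\mathbb{Z}^d: n\in\mathbb{Z}\}$ be the diagonal line, let $\tau_{d,l_d}=\inf\{n\ge 1: X_{d,n}\in l_d\}$, and let $P_d=P(\tau_{d,l_d}<\infty)$. Then $$\lim_{d\to\infty}2dP_d=1.$$
   Context: $d$-dimensional simple random walk moves at each step to one of the $2d$ nearest neighbors in $\mathbb{Z}^d$ with equal probability, independently. Convention: $\inf\emptyset=\infty$. *)

(* Defs.v *)
From HB Require Import structures.
From mathcomp Require Import all_boot all_order all_algebra.
From mathcomp Require Import finmap.
From mathcomp Require Import all_classical all_reals all_analysis.

Set Implicit Arguments.
Unset Strict Implicit.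
Unset Printing Implicit Defensive.

Import Order.TTheory GRing.Theory Num.Theory.
Import numFieldNormedType.Exports.

Local Open Scope classical_set_scope.
Local Open Scope ring_scope.

(* Z^d, equipped with the discrete sigma-algebra. *)
Definition Zd (d : nat) := 'rV[int]_d.

HB.instance Definition _ (d : nat) := GRing.Zmodule.on (Zd d).
HB.instance Definition _ (d : nat) := isPointed.Build (Zd d) 0.
HB.instance Definition _ (d : nat) :=
  @isMeasurable.Build default_measure_display (Zd d)
    (@discrete_measurable (Zd d)) (@discrete_measurable0 (Zd d))
    (@discrete_measurableC (Zd d)) (@discrete_measurableU (Zd d)).

Definition nearest_neighbor (d : nat) (x y : Zd d) : Prop :=
  \sum_(i < d) `|y 0 i - x 0 i| = 1.

Definition mutually_independent (disp disp' : measure_display)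
    (T : measurableType disp) (T' : measurableType disp') (R : realType)
    (P : probability T R) (Y : nat -> T -> T') : Prop :=
  forall (J : {fset nat}) (A : nat -> set T'),
    (forall n, n \in J -> measurable (A n)) ->
    P (\bigcap_(n in [set` J]) (Y n @^-1` A n)) =
      (\prod_(n <- J) P (Y n @^-1` A n))%E.

Definition increment (d : nat) (T : Type) (X : nat -> T -> Zd d)
    (n : nat) (w : T) : Zd d := X n.+1 w - X n w.

(* For d = 0 there is no nearest neighbor and this is not a meaningful notion:
   it is only to be used with 0 < d. *)
Definition simple_random_walk (d : nat) (disp : measure_display)
    (T : measurableType disp) (R : realType) (P : probability T R)
    (X : nat -> {RV P >-> Zd d}) : Prop :=
  [/\ forall w, X 0%N w = 0,
      mutually_independent P (increment X) &
      forall (n : nat) (e : Zd d), nearest_neighbor 0 e ->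
        P (increment X n @^-1` [set e]) = ((2 * d)%:R^-1)%:E].

Definition diagonal_line (d : nat) : set (Zd d) :=
  [set x | exists k : int, x = const_mx k].
Arguments diagonal_line d : clear implicits.

(* The index n = 0 is excluded; the value is +oo when L is never visited at a
   positive time, since ereal_inf set0 = +oo. *)
Definition hitting_time (R : realType) (T S : Type) (X : nat -> T -> S)
    (L : set S) (w : T) : \bar R :=
  ereal_inf [set n%:R%:E | n in [set n : nat | (1 <= n)%N /\ L (X n w)]].

(* Main.v *)
Require Import Defs.
From HB Require Import structures.
From mathcomp Require Import all_boot all_order all_algebra.
From mathcomp Require Import finmap zify ring lra.
From mathcomp Require Import all_classical all_reals all_analysis.

Set Implicit Arguments.
Unset Strict Implicit.
Unset Printing Implicit Defensive.

Import Order.TTheory GRing.Theory Num.Theory.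
Import numFieldNormedType.Exports.

Local Open Scope classical_set_scope.
Local Open Scope ring_scope.

(** Write [a n] for the probability that the walk is on the diagonal at time
[n], so that [a 1 = 0] and [a 2 = 1 / 2d] in large dimension.  On the one hand
the walk is back on the diagonal at time 2 as soon as its second step undoes
the first one, hence [1 / 2d <= P_d].  On the other hand [P_d] is at most the
sum of the [a n], [n >= 1], and it is enough to show that the terms with
[n >= 3] contribute [O(1 / d^2)].  Independence enters only through the identity
[a n = (avg^n 1_line) 0], where [avg] averages a function over the [2d]
neighbours ([probability_walk]); the rest is about iterates of this operator,
bounded in two regimes.

- Short times.  Returning to a point requires the steps to cancel in pairs, and
  each pair costs a factor [1 / 2d].  By induction on [n], the probability of
  being at a given point at l1-distance [D] after [n] steps is at most a
  constant times [(2d)^-ceil((n + D) / 2)] ([iter_avg_point]).  For fixed [n] and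
  large [d] at most one point of the diagonal is within reach, whence
  [a n = O(d^-2)] for [3 <= n <= 7]; at time 8 the bound is [O(d^-4)] from any
  starting point, and so it persists at all later times
  ([iter_avg_diagonal_sup]).

- Long times.  Let [Q] be the squared Euclidean distance to the diagonal.  One
  step changes [Q] by [1 - 1/d] plus a centred term whose variance is [4 Q / d],
  and in high dimension the drift beats the convexity of the inverse square:
  [avg ((t + Q)^-2) <= (t + 1/2 + Q)^-2] ([avg_inverse_square]).  Iterating from
  [t = 7] gives [a n <= 49 / (7 + n/2)^2], uniformly in [d]
  ([iter_avg_diagonal_decay]).

For [n >= 8] the two bounds combine into [a n <= C / (d^2 + n)^2], whose sum
over [n] is at most [C / d^2] by telescoping.  Hence
[1 <= 2d P_d <= 1 + O(1 / d)]. *)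

(** * Steps of the walk and the averaging operator *)

(** The second component selects the sign, [true] standing for [-1], so that
the [2d] unit vectors are indexed without repetition by a finite type. *)
Definition step (d : nat) (s : 'I_d * bool) : Zd d :=
  (\row_j ((j == s.1)%:R * (-1) ^+ s.2)) : 'rV[int]_d.

Definition avg (R : realType) (d : nat) (f : Zd d -> R) (x : Zd d) : R :=
  (2 * d)%:R^-1 * \sum_(s : 'I_d * bool) f (x + step s).

Lemma sum_step (V : nmodType) (d : nat) (F : 'I_d * bool -> V) :
  \sum_(s : 'I_d * bool) F s = \sum_(i < d) (F (i, false) + F (i, true)).
Proof.
transitivity (\sum_(i < d) \sum_(b : bool) F (i, b)).
  by rewrite pair_bigA; apply: eq_bigr => -[].
by apply: eq_bigr => i _; rewrite big_bool addrC.
Qed.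

Lemma step_coord d (i j : 'I_d) b :
  step (i, b) 0 j = (j == i)%:R * (-1) ^+ b.
Proof. by rewrite mxE. Qed.

Lemma opp_step d (i : 'I_d) b : - step (i, b) = step (i, ~~ b).
Proof.
apply/rowP => j; rewrite mxE !step_coord -mulrN.
by case: b => /=; rewrite ?expr0 ?expr1 ?opprK.
Qed.

Lemma step_inj d : injective (@step d).
Proof.
move=> [i b] [j c] /rowP E.
have := E i; rewrite !step_coord eqxx mul1r.
by case: eqP => [->|_]; case: b {E}; case: c.
Qed.

Lemma card_steps d : #|{: 'I_d * bool}| = (2 * d)%N.
Proof. by rewrite card_prod card_ord card_bool mulnC. Qed.

Lemma ler_avg (R : realType) d (f g : Zd d -> R) x :
  (forall s, f (x + step s) <= g (x + step s)) -> avg f x <= avg g x.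
Proof.
by move=> fg; apply: ler_wpM2l; [rewrite invr_ge0 ler0n | apply: ler_sum].
Qed.

Lemma avg_cst (R : realType) d (c : R) x : (0 < d)%N ->
  avg (fun _ : Zd d => c) x = c.
Proof.
move=> d0; rewrite /avg sumr_const card_steps -[c *+ _]mulr_natl mulKf//.
by rewrite pnatr_eq0; lia.
Qed.

Lemma avgD (R : realType) d (f g : Zd d -> R) x :
  avg (fun y => f y + g y) x = avg f x + avg g x.
Proof. by rewrite /avg -mulrDr big_split. Qed.

Lemma avgZ (R : realType) d c (f : Zd d -> R) x :
  avg (fun y => c * f y) x = c * avg f x.
Proof. by rewrite /avg [RHS]mulrCA; congr (_ * _); rewrite mulr_sumr. Qed.

(** * Short times: steps cancel in pairs *)

Definition l1 (d : nat) (x : Zd d) : nat := (\sum_(j < d) `|x 0%R j|)%N.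

Lemma l1_0 d : l1 (0 : Zd d) = 0%N.
Proof. by rewrite /l1 big1 // => j _; rewrite mxE. Qed.

Lemma l1D d (x y : Zd d) : (l1 (x + y)%R <= l1 x + l1 y)%N.
Proof.
rewrite /l1 -big_split /=; apply: leq_sum => j _; rewrite !mxE.
have absD (a b : int) : (`|(a + b)%R| <= `|a| + `|b|)%N by lia.
exact: absD.
Qed.

Lemma l1_step d (v : Zd d) (s : 'I_d * bool) :
  (l1 (v + step s)%R + `|v 0%R s.1| = l1 v + `|(v 0 s.1 + (-1) ^+ s.2)%R|)%N.
Proof.
case: s => i b; rewrite /l1 (bigD1 i) //= [in RHS](bigD1 i) //=.
rewrite [X in (_ + X + _)%N = _](eq_bigr (fun j => `|v 0%R j|%N)).
  by rewrite !mxE eqxx mul1r addnAC [in RHS]addnAC [X in (X + _)%N]addnC.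
by move=> j /negbTE ji; rewrite !mxE ji mul0r addr0.
Qed.

Lemma l1_stepP d (v : Zd d) (s : 'I_d * bool) :
  (0 < l1 v)%N /\ l1 (v + step s) = (l1 v).-1 \/
  l1 (v + step s) = (l1 v).+1.
Proof.
have := l1_step v s; case: s.2; rewrite ?expr0 ?expr1; lia.
Qed.

(** In each coordinate at most one of the two signs brings the walk closer to the
origin, and none does if that coordinate vanishes. *)
Lemma sum_descending d (v : Zd d) :
  (\sum_(s : 'I_d * bool) (l1 (v + step s)%R < l1 v) <= l1 v)%N.
Proof.
rewrite sum_step [leqRHS]/l1; apply: leq_sum => i _.
have := l1_step v (i, false); have := l1_step v (i, true).
rewrite /= expr0 expr1; lia.
Qed.

(** The number of ways to pair up some of [n] points with each other and the
others with [D] distinguishable targets, each target being used exactly once: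
the first point takes one of the [D] targets or becomes a target itself.  For
[D = 0] these are the perfect matchings, 1, 0, 1, 0, 3, 0, 15, ... in number. *)
Fixpoint pairings (n D : nat) : nat :=
  if n is m.+1 then (D * pairings m D.-1 + pairings m D.+1)%N
  else D == 0%N.

Lemma pairings_eq0 n D : (n < D)%N -> pairings n D = 0%N.
Proof.
elim: n D => [|n IH] D nD /=; first by rewrite gtn_eqF.
by rewrite !IH ?muln0 //; lia.
Qed.

Lemma pairings_bounded n : exists K, forall D, (pairings n D <= K)%N.
Proof.
exists (\max_(D < n.+1) pairings n D) => D.
have [nD|Dn] := ltnP n D; first by rewrite pairings_eq0.
have Dn1 : (D < n.+1)%N by [].
exact: (@leq_bigmax _ (fun i : 'I_n.+1 => pairings n i) (Ordinal Dn1)).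
Qed.

(** After [n] steps from [x] the walk is within l1-distance [n] of [x], so only
the values of the function on that ball count. *)
Lemma iter_avg_local (R : realType) d n (f g : Zd d -> R) x :
  (forall y, (l1 (y - x)%R <= n)%N -> f y <= g y) ->
  iter n (@avg R d) f x <= iter n (@avg R d) g x.
Proof.
elim: n x => [|n IH] x fg /=.
  by apply: fg; rewrite subrr l1_0.
apply: ler_avg => s; apply: IH => y yx; apply: fg.
have -> : y - x = y - (x + step s) + step s by rewrite opprD addrA subrK.
have := l1D (y - (x + step s)) (step s).
have -> : l1 (step s) = 1%N.
  have := l1_step 0 s; rewrite add0r !mxE add0r.
  by rewrite l1_0 absz0 addn0 add0n => ->; case: s.2.
by rewrite addn1 => le; apply: leq_trans le _; rewrite ltnS.
Qed.

(** Conditioning on the first step: at most [D] of the [2d] steps decrease the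
distance [D] to the target, so the exponent lost in this case, [n + D - 1]
instead of [n + 1 + D] under [uphalf], is made up for by the probability
[D / 2d] of such a step.  The other steps lead to distance [D + 1], with the right
exponent.  The recursion that is left for the constants is that of [pairings]. *)
Lemma iter_avg_point (R : realType) d n (c x : Zd d) : (0 < d)%N ->
  iter n (@avg R d) \1_[set c] x <=
  (pairings n (l1 (x - c)))%:R * (2 * d)%:R^-1 ^+ uphalf (n + l1 (x - c)).
Proof.
move=> d0; set w : R := (2 * d)%:R^-1.
have w0 : 0 <= w by rewrite invr_ge0 ler0n.
have dw : (2 * d)%:R * w = 1 by rewrite mulfV// pnatr_eq0; lia.
elim: n x => [|n IH] x.
  rewrite /= indicE; case: (boolP (x \in [set c])).
    by rewrite inE => ->; rewrite subrr l1_0 mul1r.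
  by move=> _; rewrite mulr_ge0 ?exprn_ge0.
rewrite iterS /avg -/w; set v := x - c; set D := l1 v.
set down := (pairings n D.-1)%:R * w ^+ uphalf (n + D.-1).
set up := (pairings n D.+1)%:R * w ^+ uphalf (n + D.+1).
have down0 : 0 <= down by rewrite mulr_ge0 ?exprn_ge0.
have up0 : 0 <= up by rewrite mulr_ge0 ?exprn_ge0.
have le_sum : \sum_(s : 'I_d * bool) iter n (@avg R d) \1_[set c] (x + step s)
    <= D%:R * down + (2 * d)%:R * up.
  apply: (@le_trans _ _ (\sum_(s : 'I_d * bool)
      ((l1 (v + step s)%R < D)%N%:R * down + up))).
    apply: ler_sum => s _; apply: le_trans (IH _) _.
    have -> : x + step s - c = v + step s by rewrite addrAC.
    case: (l1_stepP v s) => [[D0 ->]|->]; rewrite -/D.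
      by rewrite prednK// leqnn mul1r -/down lerDl.
    by rewrite -/up lerDr mulr_ge0.
  rewrite big_split /= sumr_const card_steps -mulr_suml -[up *+ _]mulr_natl.
  by rewrite lerD2r ler_wpM2r // -natr_sum ler_nat sum_descending.
apply: le_trans (ler_wpM2l w0 le_sum) _.
have -> : w * (D%:R * down + (2 * d)%:R * up) = D%:R * (w * down) + up.
  rewrite mulrDr [w * (D%:R * _)]mulrCA [w * (_ * up)]mulrCA.
  by rewrite [X in _ + X]mulrA dw mul1r.
rewrite natrD natrM mulrDl lerD //; last by rewrite /up addnS addSn.
rewrite /down; case: (D) => [|D']; first by rewrite !mul0r.
by rewrite addSn addnS /= exprS -mulrA [w * (_ * _)]mulrCA.
Qed.

Lemma l1_const d (k : int) : l1 (const_mx k : Zd d) = (d * `|k|)%N.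
Proof.
rewrite /l1 (eq_bigr (fun=> `|k|%N)); last by move=> j _; rewrite mxE.
by rewrite sum_nat_const card_ord.
Qed.

Lemma l1_sym d (x y : Zd d) : l1 (x - y) = l1 (y - x).
Proof. by apply: eq_bigr => j _; rewrite !mxE -abszN opprB. Qed.

(** Two points of the diagonal cannot both be within distance [n] of [x] when
[2n < d], so hitting the line amounts to hitting [c]. *)
Lemma iter_avg_diagonal_near (R : realType) d n (x c : Zd d) : (2 * n < d)%N ->
  diagonal_line d c -> (l1 (c - x)%R <= n)%N ->
  iter n (@avg R d) \1_(diagonal_line d) x <= iter n (@avg R d) \1_[set c] x.
Proof.
move=> nd lc cx; apply: iter_avg_local => y yx; rewrite !indicE.
case: (boolP (y \in diagonal_line d)); last by rewrite ler0n.
rewrite inE => ly; suff -> : y = c by rewrite mem_set.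
move: lc ly cx yx => [k ->] [m ->] cx yx.
have := l1D (const_mx m - x) (x - const_mx k).
rewrite addrA subrK (l1_sym x) => le.
have : (d * `|(m - k)%R| <= n + n)%N.
  rewrite -l1_const; apply: leq_trans (leq_trans le (leq_add yx cx)).
  by apply/eq_leq; congr l1; apply/rowP => j; rewrite !mxE.
(* Distinct diagonal points are at least [d > 2n] apart. *)
have [->//|mk] := eqVneq m k; nia.
Qed.

Lemma iter_avg_diagonal0 (R : realType) d n : (2 * n < d)%N ->
  iter n (@avg R d) \1_(diagonal_line d) 0 <=
  (pairings n 0)%:R * (2 * d)%:R^-1 ^+ uphalf n.
Proof.
move=> nd; have l00 : l1 (0 - 0 : Zd d) = 0%N by rewrite subrr l1_0.
have l0 : diagonal_line d 0 by exists 0; apply/rowP => j; rewrite !mxE.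
apply: le_trans (iter_avg_diagonal_near R nd l0 _) _; first by rewrite l00.
have := @iter_avg_point R d n 0 0; rewrite l00 addn0; apply; lia.
Qed.

(** A bound from every starting point, in contrast with [iter_avg_diagonal0],
is inherited by all later times. *)
Lemma iter_avg_diagonal_sup (R : realType) n : exists K : nat,
  forall d m (x : Zd d), (2 * n < d)%N -> (n <= m)%N ->
  iter m (@avg R d) \1_(diagonal_line d) x <= K%:R * (2 * d)%:R^-1 ^+ uphalf n.
Proof.
have [K pK] := pairings_bounded n; exists K => d m x nd nm.
have d0 : (0 < d)%N by lia.
have w0 : 0 <= (2 * d)%:R^-1 :> R by rewrite invr_ge0 ler0n.
have w1 : (2 * d)%:R^-1 <= 1 :> R.
  by rewrite invf_le1 ?ltr0n ?ler1n; lia.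
have Kw : 0 <= K%:R * (2 * d)%:R^-1 ^+ uphalf n :> R.
  by rewrite mulr_ge0 ?exprn_ge0.
(* An average of values below a constant is below it: time [n] is enough. *)
rewrite -(subnK nm); elim: (m - n)%N x => [|k IH] x; last first.
  rewrite addSn iterS -[leRHS](avg_cst (d := d) _ x) //.
  by apply: ler_avg => s; exact: IH.
rewrite add0n.
have [[c [lc cx]]|far] :=
    pselect (exists c, diagonal_line d c /\ (l1 (c - x)%R <= n)%N).
  apply: le_trans (iter_avg_diagonal_near R nd lc cx) _.
  apply: le_trans (iter_avg_point _ _ _ _ d0) _.
  rewrite ler_pM ?exprn_ge0 ?ler_nat//.
  by apply: ler_wiXn2l => //; apply: uphalf_leq; exact: leq_addr.
apply: le_trans Kw => {w1}; have -> : 0 = iter n (@avg R d) (fun=> 0) x.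
  elim: n {far nd pK nm} x => //= k IH x.
  by rewrite -[LHS](avg_cst 0 x d0); congr avg; apply/funext => y; rewrite -IH.
apply: iter_avg_local => y yx; rewrite indicE memNset ?ler0n// => ly.
by apply: far; exists y.
Qed.

(** * Long times: the squared distance to the diagonal *)

(** The squared Euclidean distance to the real diagonal line, that is the sum of
the squared deviations from the mean of the coordinates ([spreadE]), in the
expanded form which shows how one step changes it. *)
Definition spread (R : realType) (d : nat) (x : Zd d) : R :=
  \sum_(j < d) (x 0 j)%:~R ^+ 2 - (\sum_(j < d) (x 0 j)%:~R) ^+ 2 / d%:R.

Definition deviation (R : realType) (d : nat) (x : Zd d) (i : 'I_d) : R :=
  (x 0 i)%:~R - (\sum_(j < d) (x 0 j)%:~R) / d%:R.

Lemma spreadE (R : realType) d (x : Zd d) :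
  spread R x = \sum_(i < d) deviation R x i ^+ 2.
Proof.
rewrite /spread /deviation; case: d x => [|d] x.
  by rewrite !big_ord0 expr0n mul0r subr0.
set S := \sum_(j < _) _%:~R; set m := S / _.
rewrite [RHS](eq_bigr (fun i =>
    (x 0 i)%:~R ^+ 2 + ((- 2 * m) * (x 0 i)%:~R + m ^+ 2)));
  last by move=> i _; ring.
rewrite !big_split /= -mulr_sumr -/S sumr_const card_ord.
rewrite -[m ^+ 2 *+ _]mulr_natr {}/m.
have : d.+1%:R != 0 :> R by rewrite pnatr_eq0.
by move: (d.+1%:R) => D D0; field.
Qed.

Lemma spread_step (R : realType) d (x : Zd d) (s : 'I_d * bool) :
  spread R (x + step s) =
  spread R x + (1 - d%:R^-1) + 2 * ((-1) ^+ s.2 * deviation R x s.1).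
Proof.
case: s => i b; have d0 : d%:R != 0 :> R.
  by rewrite pnatr_eq0 -lt0n (leq_trans _ (ltn_ord i)).
rewrite /spread /deviation /=; set e : R := (-1) ^+ b.
have e2 : e ^+ 2 = 1 by rewrite /e sqrr_sign.
have stepE j : ((x + step (i, b)) 0 j)%:~R = (x 0 j)%:~R + (j == i)%:R * e :> R.
  rewrite !mxE intrD intrM; congr (_ + _ * _); first by case: (j == i).
  by rewrite /e rmorphXn /= rmorphN rmorph1.
rewrite !(eq_bigr _ (fun j _ => stepE j)).
rewrite (eq_bigr (fun j => (x 0 j)%:~R ^+ 2 +
    (j == i)%:R * (2 * e * (x 0 j)%:~R + 1))); last first.
  move=> j _; rewrite stepE; case: (j == i); last by rewrite !mul0r !addr0.
  by rewrite !mul1r sqrrD e2; ring.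
rewrite !big_split /= -mulr_suml.
have pick (F : 'I_d -> R) : \sum_j (j == i)%:R * F j = F i.
  rewrite (bigD1 i) //= eqxx mul1r big1 ?addr0// => j /negbTE ->.
  by rewrite mul0r.
rewrite pick (_ : \sum_j (j == i)%:R = 1); last first.
  by rewrite -[RHS](pick (fun=> 1)); apply: eq_bigr => j _; rewrite mulr1.
by move: (d%:R) d0 => D D0; field: e2.
Qed.

(** The second-order Taylor bound for the convex function [u^-2], with the
constant 6 of its second derivative relaxed to 8 so that it holds exactly for
all increments up to [u / sqrt 7]. *)
Lemma inverse_square_pair (R : realType) (u h : R) : 0 < u ->
  7 * h ^+ 2 <= u ^+ 2 ->
  (u + h) ^- 2 + (u - h) ^- 2 <= 2 * u ^- 2 + 8 * h ^+ 2 * u ^- 4.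
Proof.
move=> u0 hu.
have uh : 0 < u ^+ 2 - h ^+ 2 by nra.
have uh1 : u + h != 0.
  by apply: contraTN uh => /eqP E; rewrite subr_sqr E mulr0 ltxx.
have uh2 : u - h != 0.
  by apply: contraTN uh => /eqP E; rewrite subr_sqr E mul0r ltxx.
have -> : 2 * u ^- 2 + 8 * h ^+ 2 * u ^- 4 =
   (u + h) ^- 2 + (u - h) ^- 2 +
   2 * h ^+ 2 * (u ^+ 4 - 7 * u ^+ 2 * h ^+ 2 + 4 * h ^+ 4) /
   (u ^+ 4 * (u ^+ 2 - h ^+ 2) ^+ 2).
  field.
  by rewrite uh1 uh2 (gt_eqF u0) (gt_eqF uh).
rewrite lerDl; apply: divr_ge0; last by rewrite mulr_ge0 ?exprn_ge0 ?ltW.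
apply: mulr_ge0; first by rewrite mulr_ge0 ?sqr_ge0.
have : 0 <= u ^+ 2 * (u ^+ 2 - 7 * h ^+ 2) by rewrite mulr_ge0 ?sqr_ge0 ?subr_ge0.
have : 0 <= h ^+ 4 by rewrite -[4%N]/(2 * 2)%N exprM sqr_ge0.
by nra.
Qed.

(** Averaging over the two signs of a step along coordinate [i] cancels the
linear term [2 v_i] of the increment of [spread], and its square contributes
[32 v_i^2 u^-4], where [u] includes the drift [1 - 1/d].  Since the [v_i^2] sum
to at most [u], the mean over [i] is [u^-2 + O(u^-3 / d)], and half of the drift
is enough to pay for the error term. *)
Lemma avg_inverse_square (R : realType) d (t : R) (x : Zd d) :
  (64 <= d)%N -> 7 <= t ->
  avg (fun y => (t + spread R y) ^- 2) x <= (t + 2^-1 + spread R x) ^- 2.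
Proof.
move=> d64 t7; set q := spread R x; set D : R := d%:R.
have D64 : 64 <= D by rewrite ler_nat.
have q0 : 0 <= q by rewrite /q spreadE; apply: sumr_ge0 => i _; exact: sqr_ge0.
have Dinv : D^-1 <= 64^-1 by rewrite lef_pV2 ?posrE; lra.
have Dinv0 : 0 < D^-1 by rewrite invr_gt0; lra.
set u := t + q + (1 - D^-1).
have u7 : 7 + q <= u by rewrite /u; lra.
have u0 : 0 < u by lra.
have pair_bound i : (t + spread R (x + step (i, false))) ^- 2 +
    (t + spread R (x + step (i, true))) ^- 2 <=
    2 * u ^- 2 + 32 * deviation R x i ^+ 2 * u ^- 4.
  rewrite !spread_step /= expr0 expr1 mul1r mulN1r mulrN.
  set v := deviation R x i.
  have vq : v ^+ 2 <= q.
    rewrite /q spreadE (bigD1 i) //= lerDl.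
    by apply: sumr_ge0 => j _; exact: sqr_ge0.
  have -> : 32 * v ^+ 2 = 8 * (2 * v) ^+ 2 by ring.
  have uE w : t + (q + (1 - D^-1) + w) = u + w by rewrite /u; ring.
  rewrite -/q -/D !uE; apply: inverse_square_pair => //.
  (* [28 v^2 <= 28 (u - 7) <= u^2], the last step being [(u - 14)^2 >= 0];
     this is what the constant 7 is for. *)
  have := sqr_ge0 (u - 14); nra.
have avg_bound : avg (fun y => (t + spread R y) ^- 2) x <=
    u ^- 2 + 16 * q * u ^- 4 / D.
  rewrite /avg sum_step; apply: (@le_trans _ _ ((2 * d)%:R^-1 *
     \sum_(i < d) (2 * u ^- 2 + 32 * deviation R x i ^+ 2 * u ^- 4))).
    by rewrite ler_wpM2l ?invr_ge0 ?ler0n// ler_sum.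
  rewrite big_split /= sumr_const card_ord -mulr_suml -mulr_sumr -spreadE -/q.
  rewrite -mulr_natr -/D natrM -/D le_eqVlt; apply/orP; left; apply/eqP.
  by field; rewrite !gt_eqF //; lra.
apply: le_trans avg_bound _.
have q_le : 16 * q * u ^- 4 / D <= 4^-1 * u ^- 3.
  have -> : 4^-1 * u ^- 3 = 16 * u * u ^- 4 * 64^-1 by field; rewrite gt_eqF.
  have u4 : 0 <= u ^- 4 by rewrite invr_ge0 exprn_ge0 // ltW.
  apply: ler_pM => //; [|exact: ltW|].
    by rewrite !mulr_ge0.
  by rewrite ler_wpM2r // ler_wpM2l //; lra.
apply: (@le_trans _ _ (u ^- 2 + 4^-1 * u ^- 3)); first by rewrite lerD2l.
apply: (@le_trans _ _ ((u - 4^-1) ^- 2)); last first.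
  by rewrite lef_pV2 ?posrE ?exprn_gt0 ?ler_sqr ?nnegrE /u; lra.
have -> : (u - 4^-1) ^- 2 = u ^- 2 + 4^-1 * u ^- 3 +
    (u ^+ 2 / 4 + u / 16 - 1 / 64) / (u ^+ 3 * (u - 4^-1) ^+ 2).
  by field; rewrite !gt_eqF //; lra.
rewrite lerDl; apply: divr_ge0; first by nra.
by rewrite mulr_ge0 ?sqr_ge0 // exprn_ge0 // ltW.
Qed.

(** [49 (7 + Q)^-2] dominates the indicator of the line, where [Q = 0], and each
averaging moves the parameter by [1/2]. *)
Lemma iter_avg_diagonal_decay (R : realType) d n (x : Zd d) : (64 <= d)%N ->
  iter n (@avg R d) \1_(diagonal_line d) x <=
  7 ^+ 2 * (7 + n%:R / 2 + spread R x) ^- 2.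
Proof.
move=> d64; elim: n x => [|n IH] x; last first.
  pose g (y : Zd d) := (7 + n%:R / 2 + spread R y) ^- 2.
  apply: (@le_trans _ _ (avg (fun y => 7 ^+ 2 * g y) x)).
    by rewrite iterS; apply: ler_avg => s; exact: IH.
  rewrite avgZ ler_wpM2l ?sqr_ge0//.
  apply: le_trans (avg_inverse_square _ d64 _) _; first by rewrite lerDl mulr_ge0.
  rewrite le_eqVlt; apply/orP; left; apply/eqP; congr ((_ + _) ^- 2).
  by rewrite -natr1; field.
rewrite mul0r addr0 /= indicE.
case: (boolP (x \in diagonal_line d)); last first.
  by move=> _; rewrite mulr_ge0 ?sqr_ge0 // invr_ge0 sqr_ge0.
rewrite inE => -[k ->]; suff -> : spread R (const_mx k : Zd d) = 0.
  by rewrite addr0 mulfV // expf_neq0 // pnatr_eq0.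
have d0 : d%:R != 0 :> R by rewrite pnatr_eq0; lia.
rewrite spreadE big1 // => i _; rewrite /deviation mxE.
rewrite (eq_bigr (fun=> k%:~R)); last by move=> j _; rewrite mxE.
by rewrite sumr_const card_ord -[_ *+ d]mulr_natr mulfK// subrr expr0n.
Qed.

(** * Probabilities as iterated averages *)

Lemma fsum_finType (R : realType) (I : finType) (F : I -> \bar R) :
  (\sum_(i \in [set: I]) F i = \sum_i F i)%E.
Proof.
rewrite (_ : [set: I] = [set` index_enum I]) ?(fsbig_seq _ _ (index_enum_uniq I)) //.
by apply/seteqP; split => // i _ /=; rewrite mem_index_enum.
Qed.

(** The difference of two random variables is handled through the countability of
the lattice, by fixing the value of the first one. *)
Lemma measurable_increment d (disp : measure_display) (T : measurableType disp)
    (R : realType) (P : probability T R) (X : nat -> {RV P >-> Zd d}) n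
    (A : set (Zd d)) : measurable (increment X n @^-1` A).
Proof.
have -> : increment X n @^-1` A =
    \bigcup_(x : Zd d) (X n @^-1` [set x] `&` X n.+1 @^-1` [set y | A (y - x)]).
  apply/seteqP; split => [w Aw|w [x _ [/= <-]]] //.
  by exists (X n w).
apply: countable_bigcupT_measurable => [|x].
  exact: (@countableP ('rV[int]_d) setT).
by apply: measurableI; apply: measurable_funPTI.
Qed.

Lemma nearest_neighbor_step d (s : 'I_d * bool) : nearest_neighbor 0 (step s).
Proof.
case: s => i b; rewrite /nearest_neighbor (bigD1 i) //= big1 => [|j /negbTE ji].
  by rewrite !mxE eqxx mul1r subr0 addr0 normr_sign.
by rewrite !mxE ji mul0r subr0 normr0.
Qed.

Definition cylinder d (T : Type) (X : nat -> T -> Zd d)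
    (es : seq ('I_d * bool)) : set T :=
  [set w | forall i, (i < size es)%N ->
     increment X i w = nth 0 (map (@step d) es) i].

Lemma cylinder_rcons d (T : Type) (X : nat -> T -> Zd d) es s :
  cylinder X (rcons es s) =
  cylinder X es `&` increment X (size es) @^-1` [set step s].
Proof.
apply/seteqP; split => w /=; rewrite /cylinder /= size_rcons map_rcons.
  move=> H; split=> [i ies|].
    by rewrite (H i (leqW ies)) nth_rcons size_map ies.
  by rewrite /preimage /= (H _ (ltnSn _)) nth_rcons size_map ltnn eqxx.
case=> H Hs i; rewrite ltnS leq_eqVlt nth_rcons size_map => /orP[/eqP ->|ies].
  by rewrite ltnn eqxx; exact: Hs.
by rewrite ies; exact: H.
Qed.

Lemma cylinder_position d (T : Type) (X : nat -> T -> Zd d) es w :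
  X 0%N w = 0 -> cylinder X es w -> X (size es) w = \sum_(s <- es) step s.
Proof.
move=> X0; elim/last_ind: es => [|es s IH]; first by rewrite big_nil.
rewrite cylinder_rcons => -[/IH E Xs].
by rewrite size_rcons big_rcons /= -E -Xs /increment addrC subrK.
Qed.

Lemma measurable_cylinder d (disp : measure_display) (T : measurableType disp)
    (R : realType) (P : probability T R) (X : nat -> {RV P >-> Zd d}) es :
  measurable (cylinder X es).
Proof.
elim/last_ind: es => [|es s IH]; last first.
  by rewrite cylinder_rcons; apply: measurableI => //; exact: measurable_increment.
by rewrite (_ : cylinder _ _ = setT) //; apply/seteqP; split.
Qed.

Lemma probability_cylinder d (disp : measure_display) (T : measurableType disp)
    (R : realType) (P : probability T R) (X : nat -> {RV P >-> Zd d}) es :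
  simple_random_walk X ->
  P (cylinder X es) = ((2 * d)%:R^-1 ^+ size es)%:E.
Proof.
move=> [_ indep unif]; pose J : {fset nat} := [fset i in iota 0 (size es)]%fset.
have inJ i : (i \in J) = (i < size es)%N by rewrite !inE mem_iota.
have -> : cylinder X es = \bigcap_(n in [set` J])
    (increment X n @^-1` [set nth 0 (map (@step d) es) n]).
  apply/seteqP; split => w H i /=; first by rewrite inJ; exact: H.
  by move=> ies; apply: H; rewrite /= inJ.
rewrite (indep J (fun n => [set nth 0 (map (@step d) es) n])) //.
rewrite (eq_big_seq (fun=> ((2 * d)%:R^-1)%:E)) => [|i]; last first.
  rewrite inJ => ies; apply: unif.
  have [s0 _] : exists s, s \in es.
    by case: (es) ies => // s ? _; exists s; rewrite mem_head.
  by rewrite (nth_map s0) //; exact: nearest_neighbor_step.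
rewrite (perm_big (iota 0 (size es))); last first.
  by apply: uniq_perm => [||i]; rewrite ?fset_uniq ?iota_uniq // inJ mem_iota.
by rewrite prodEFin big_const_seq count_predT size_iota iter_mulr mulr1.
Qed.

(** The [2d] steps already carry the whole mass of an increment. *)
Lemma increment_step_as d (disp : measure_display) (T : measurableType disp)
    (R : realType) (P : probability T R) (X : nat -> {RV P >-> Zd d}) n :
  (0 < d)%N -> simple_random_walk X ->
  P (~` \bigcup_(s in [set: 'I_d * bool]) (increment X n @^-1` [set step s])) = 0.
Proof.
move=> d0 [_ _ unif].
have mY s : measurable (increment X n @^-1` [set step s]).
  exact: measurable_increment.
rewrite probability_setC; last first.
  by apply: fin_bigcup_measurable => //; exact: finite_finset.
rewrite measure_fin_bigcup //; first last.
- move=> s s' _ _ [w [/= ->]]; exact: step_inj.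
- exact: finite_finset.
rewrite fsum_finType (eq_bigr (fun=> ((2 * d)%:R^-1)%:E)); last first.
  by move=> s _; apply: unif; exact: nearest_neighbor_step.
rewrite sumEFin sumr_const card_steps -[_ *+ _]mulr_natl mulfV ?subee//.
by rewrite pnatr_eq0; lia.
Qed.

(** Induction on the number [m] of remaining steps, over all prescribed initial
segments [es] at once: splitting according to the next increment extends the
segment by one step, up to a null event. *)
Lemma walk_le_iter_avg d (disp : measure_display) (T : measurableType disp)
    (R : realType) (P : probability T R) (X : nat -> {RV P >-> Zd d}) :
  (0 < d)%N -> simple_random_walk X -> forall m es (A : set (Zd d)),
  (P (cylinder X es `&` X (size es + m)%N @^-1` A) <=
   ((2 * d)%:R^-1 ^+ size es *
    iter m (@avg R d) \1_A (\sum_(s <- es) step s))%:E)%E.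
Proof.
move=> d0 hX m; elim: m => [|m IH] es A.
  rewrite addn0 /= indicE; case: (boolP (_ \in A)) => [_|/negP nA].
    rewrite mulr1 -(probability_cylinder es hX); apply: le_measure => //.
    - rewrite inE; apply: measurableI; first exact: measurable_cylinder.
      exact: measurable_funPTI.
    - by rewrite inE; exact: measurable_cylinder.
  rewrite mulr0 (_ : _ `&` _ = set0) ?measure0//.
  have [X0 _ _] := hX.
  apply/seteqP; split => // w [/(cylinder_position (X0 w)) E].
  by rewrite /preimage /= E => Aw; apply: nA; rewrite inE.
set B := cylinder X es `&` _.
have mB : measurable B.
  by apply: measurableI; [exact: measurable_cylinder|exact: measurable_funPTI].
pose Y s := increment X (size es) @^-1` [set step s].
have mY s : measurable (Y s) by exact: measurable_increment.
have null := increment_step_as (size es) d0 hX.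
set N := ~` _ in null.
have mN : measurable N.
  apply/measurableC/fin_bigcup_measurable => [|s _].
    exact: finite_finset.
  exact: mY.
pose U := \bigcup_(s in [set: 'I_d * bool]) (B `&` Y s).
have mU : measurable U.
  apply: fin_bigcup_measurable => [|s _]; [exact: finite_finset|exact: measurableI].
have BU : B `<=` U `|` N.
  move=> w Bw; have [[s _ Ys]|nY] :=
      pselect ((\bigcup_(s in [set: 'I_d * bool]) Y s) w).
    by left; exists s.
  by right.
apply: (@le_trans _ _ (P (U `|` N))).
  by apply: le_measure; rewrite ?inE //; exact: measurableU.
rewrite measureU0 //.
apply: (@le_trans _ _ (\sum_(s \in [set: 'I_d * bool]) P (B `&` Y s))%E).
  by apply: content_sub_fsum => // [|s _]; [exact: finite_finset|exact: measurableI].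
rewrite fsum_finType iterS /avg mulrA -exprSr mulr_sumr -sumEFin.
apply: lee_sum => s _.
have := IH (rcons es s) A.
rewrite cylinder_rcons size_rcons big_rcons /= addSnnS.
by rewrite /B setIAC.
Qed.

(** The upper bounds for [A] and for its complement add up to 1, so both are
equalities. *)
Lemma probability_walk d (disp : measure_display) (T : measurableType disp)
    (R : realType) (P : probability T R) (X : nat -> {RV P >-> Zd d}) n
    (A : set (Zd d)) : (0 < d)%N -> simple_random_walk X ->
  P (X n @^-1` A) = (iter n (@avg R d) \1_A 0)%:E.
Proof.
move=> d0 hX.
have le_avg B : (P (X n @^-1` B) <= (iter n (@avg R d) \1_B 0)%:E)%E.
  have := walk_le_iter_avg d0 hX n [::] B.
  rewrite big_nil expr0 mul1r add0n (_ : cylinder _ _ = setT) ?setTI //.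
  by apply/seteqP; split.
apply/eqP; rewrite eq_le le_avg /=.
have avgC : iter n (@avg R d) \1_A 0 + iter n (@avg R d) \1_(~` A) 0 = 1.
  elim: n {le_avg} (0 : Zd d) => [|n IH] x.
    rewrite /= !indicE in_setC; case: (_ \in A) => /=; by rewrite ?addr0 ?add0r.
  rewrite !iterS -avgD -[RHS](avg_cst 1 x d0); congr avg.
  by apply/funext => y; rewrite IH.
have := le_avg (~` A); rewrite preimage_setC probability_setC; last first.
  exact: measurable_funPTI.
have -> : iter n (@avg R d) \1_(~` A) 0 = 1 - iter n (@avg R d) \1_A 0.
  by rewrite -avgC addrC addKr.
have : P (X n @^-1` A) \is a fin_num.
  by apply: fin_num_measure; exact: measurable_funPTI.
case: (P _) => // r _; rewrite -EFinB !lee_fin; lra.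
Qed.

(** * Summing the return probabilities *)

(** Telescoping, from [(c + 1)^-2 <= c^-1 - (c + 1)^-1]. *)
Lemma sum_inverse_square (R : realType) (b : R) N : 0 < b ->
  \sum_(i < N) (b + i.+1%:R) ^- 2 <= b^-1.
Proof.
move=> b0; apply: (@le_trans _ _ (b^-1 - (b + N%:R)^-1)); last first.
  by rewrite gerBl invr_ge0 addr_ge0 // ltW.
elim: N => [|N IH]; first by rewrite big_ord0 addr0 subrr.
rewrite big_ord_recr /=; apply: le_trans (lerD IH (lexx _)) _.
set c := b + N%:R; have c0 : 0 < c by rewrite ltr_wpDr.
have -> : b + N.+1%:R = c + 1 by rewrite -natr1 addrA.
rewrite -addrA lerD2l -subr_ge0.
have -> : - (c + 1)^-1 - (- c^-1 + (c + 1) ^- 2) = c^-1 * (c + 1) ^- 2.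
  by field; rewrite !gt_eqF //; lra.
by rewrite mulr_ge0 // invr_ge0 ?sqr_ge0 // ltW.
Qed.

(** Up to time [d^2] the bound [O(d^-4)] is the better one, and [O(n^-2)] after
that; the right-hand side is of the order of the smaller one throughout. *)
Lemma iter_avg_diagonal_tail (R : realType) : exists C : R, 0 <= C /\
  forall d n, (64 <= d)%N -> (8 <= n)%N ->
  iter n (@avg R d) \1_(diagonal_line d) 0 <= C * (d%:R ^+ 2 + n%:R) ^- 2.
Proof.
have [K sup] := iter_avg_diagonal_sup R 8.
exists (K%:R + 28 ^+ 2); split=> [|d n d64 n8].
  by rewrite addr_ge0 ?ler0n ?sqr_ge0.
have D64 : 64 <= d%:R :> R by rewrite ler_nat.
have N8 : 8 <= n%:R :> R by rewrite ler_nat.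
have := sup d n 0 (leq_trans (isT : (16 < 64)%N) d64) n8.
have := iter_avg_diagonal_decay R n (0 : Zd d) d64.
set a := iter _ _ _ _; set D : R := d%:R in D64 *; set q := spread R _.
have q0 : 0 <= q by rewrite /q spreadE; apply: sumr_ge0 => i _; exact: sqr_ge0.
set N : R := n%:R in N8 *; rewrite natrM -/D => decay short.
have D20 : 0 < D ^+ 2 by rewrite exprn_gt0 //; lra.
have s0 : 0 < D ^+ 2 + N by lra.
have [ND|DN] := leP N (D ^+ 2).
  apply: le_trans short _; rewrite ler_pM ?exprn_ge0 ?invr_ge0 ?lerDl //; first lra.
  rewrite -[uphalf 8]/4%N exprVn lef_pV2 ?posrE ?exprn_gt0 //; last lra.
  have -> : (2 * D) ^+ 4 = (4 * D ^+ 2) ^+ 2 by ring.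
  by rewrite ler_sqr ?nnegrE; lra.
apply: le_trans decay _.
have -> : 7 ^+ 2 * (7 + N / 2 + q) ^- 2 = 28 ^+ 2 * (4 * (7 + N / 2 + q)) ^- 2 :> R.
  by field; lra.
rewrite ler_pM ?invr_ge0 ?exprn_ge0 ?lerDr //; try lra.
rewrite lef_pV2 ?posrE ?exprn_gt0 //; try lra.
by rewrite ler_sqr ?nnegrE; lra.
Qed.

Lemma sum_indicator_lt m c : (\sum_(i < m) (i < c) = minn m c)%N.
Proof.
elim: m => [|m IH]; first by rewrite big_ord0 min0n.
by rewrite big_ord_recr /= IH; lia.
Qed.

Lemma sum_indicator_eq1 m : (\sum_(i < m) (i == 1%N :> nat) = (1 < m))%N.
Proof.
elim: m => [|m IH]; first by rewrite big_ord0.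
by rewrite big_ord_recr /= IH; lia.
Qed.

Lemma sum_iter_avg_diagonal (R : realType) : exists C : R,
  forall d m, (64 <= d)%N ->
  \sum_(i < m) iter i.+1 (@avg R d) \1_(diagonal_line d) 0 <=
  (2 * d)%:R^-1 + C * d%:R ^- 2.
Proof.
have [C [C0 tail]] := iter_avg_diagonal_tail R.
exists (7 * 15 + C) => d m d64.
have D64 : 64 <= d%:R :> R by rewrite ler_nat.
set w : R := (2 * d)%:R^-1; set D : R := d%:R in D64 *.
have w0 : 0 <= w by rewrite invr_ge0 ler0n.
have D0 : 0 < D by lra.
have D2 : 0 < D ^+ 2 by rewrite exprn_gt0.
have Di : 0 <= D ^- 2 by rewrite invr_ge0 ltW.
have wD : w ^+ 2 <= D ^- 2.
  rewrite /w natrM -/D exprVn lef_pV2 ?posrE ?exprn_gt0 ?mulr_gt0 //.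
  by rewrite ler_sqr ?nnegrE; lra.
have w1 : w <= 1 by rewrite invf_le1 ?ltr0n ?ler1n; lia.
have term (i : nat) : iter i.+1 (@avg R d) \1_(diagonal_line d) 0 <=
    (i == 1%N)%:R * w + (i < 7)%N%:R * (15 * D ^- 2) +
    C * (D ^+ 2 + i.+1%:R) ^- 2.
  have rest0 : 0 <= C * (D ^+ 2 + i.+1%:R) ^- 2.
    by rewrite mulr_ge0 // invr_ge0 sqr_ge0.
  have [i7|i7] := ltnP i 7; last first.
    apply: le_trans (tail _ _ d64 _) _ => //.
    by rewrite lerDr mul0r addr0 mulr_ge0.
  apply: ler_wpDr => //; rewrite mul1r.
  apply: le_trans (iter_avg_diagonal0 _ _) _; first lia.
  rewrite -/w.
  case: i i7 {rest0} => [|[|i]] i7.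
  - by rewrite mul0r addr_ge0 ?mulr_ge0.
  - by rewrite (_ : pairings 2 0 = 1%N) // expr1 lerDl mulr_ge0.
  (* 15 is the largest of the matching numbers for [n <= 7]. *)
  have p15 : (pairings i.+3 0 <= 15)%N.
    by move: i7; do 5 (case: i => [//|i]).
  rewrite mul0r add0r ler_pM ?exprn_ge0 ?ler_nat //.
  by apply: le_trans wD; apply: ler_wiXn2l => //; lia.
apply: le_trans (ler_sum _ (fun (i : 'I_m) _ => term i)) _.
rewrite !big_split /= -!mulr_suml -mulr_sumr -!natr_sum.
rewrite sum_indicator_lt sum_indicator_eq1 [leRHS]addrC [(7 * 15 + C) * _]mulrDl
  -[7 * 15 * _]mulrA [leRHS]addrC [leRHS]addrA.
apply: lerD; last first.
  rewrite ler_wpM2l //; exact: sum_inverse_square.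
apply: lerD; first by rewrite ler_piMl // lern1 leq_b1.
by rewrite ler_wpM2r ?ler_nat ?geq_minr // mulr_ge0.
Qed.

(** Whatever the first step, the second one undoes it with probability
[1 / 2d]. *)
Lemma two_step_return (R : realType) d : (0 < d)%N ->
  (2 * d)%:R^-1 <= iter 2 (@avg R d) \1_(diagonal_line d) 0.
Proof.
move=> d0; rewrite -[leLHS](avg_cst _ (0 : Zd d) d0); apply: ler_avg => -[i b].
rewrite add0r /= /avg ler_peMr ?invr_ge0 //.
rewrite (bigD1 (i, ~~ b)) //= -opp_step subrr indicE mem_set /=.
  by rewrite lerDl; apply: sumr_ge0 => s _; rewrite indicE ler0n.
by exists 0; apply/rowP => j; rewrite !mxE.
Qed.

Lemma hitting_time_finite (R : realType) (T S : Type) (X : nat -> T -> S)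
    (L : set S) :
  [set w | hitting_time R X L w < +oo]%E = \bigcup_i X i.+1 @^-1` L.
Proof.
apply/seteqP; split => w /=.
  move=> /ereal_inf_lt[_ [n [n1 Ln] _] _].
  by case: n n1 Ln => // n _ Ln; exists n.
case=> n _ Ln; apply: (@le_lt_trans _ _ (n.+1%:R%:E : \bar R)).
  by apply: ereal_inf_lbound; exists n.+1.
exact: ltry.
Qed.

Theorem theoremA2 (R : realType) (disp : nat -> measure_display)
    (T : forall d : nat, measurableType (disp d))
    (P : forall d : nat, probability (T d) R)
    (X : forall d : nat, nat -> {RV (P d) >-> Zd d})
    (hX : forall d : nat, (0 < d)%N -> simple_random_walk (X d)) :
  ((2 * d)%N%:R%:E *
     P d [set w | hitting_time R (X d) (diagonal_line d) w < +oo])%E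
    @[d --> \oo] --> (1%:E : \bar R).
Proof.
have [C sum_le] := sum_iter_avg_diagonal R.
apply: (@squeeze_cvge _ _ _ _ (fun=> 1%E) _
  (fun d : nat => (1 + 2 * C * (d%:R)^-1)%:E)); last 2 first.
- exact: cvg_cst.
- apply: cvg_EFin; first by apply: nearW.
  rewrite -[X in _ --> X]addr0 -(mulr0 (2 * C)).
  apply: cvgD; first exact: cvg_cst.
  apply: cvgMr; apply/gtr0_cvgV0; last exact: cvgr_idn.
  by near do rewrite ltr0n; exact: nbhs_infty_gt.
near=> d.
have d64 : (64 <= d)%N by near: d; exact: nbhs_infty_ge.
have d0 : (0 < d)%N by lia.
have D0 : d%:R != 0 :> R by rewrite pnatr_eq0; lia.
rewrite hitting_time_finite; set E := \bigcup_i _.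
have mX n : measurable (X d n.+1 @^-1` diagonal_line d) by exact: measurable_funPTI.
have mE : measurable E by exact: bigcupT_measurable.
have low : ((2 * d)%:R^-1%:E <= P d E)%E.
  apply: (@le_trans _ _ (P d (X d 2 @^-1` diagonal_line d))).
    by rewrite (probability_walk _ _ d0 (hX d d0)) lee_fin two_step_return.
  by apply: le_measure; rewrite ?inE //; [exact: (mX 1) | move=> w ?; exists 1%N].
have high : (P d E <= ((2 * d)%:R^-1 + C * d%:R ^- 2)%:E)%E.
  apply: le_trans (generalized_Boole_inequality _ mX mE) _.
  apply: lime_le; first by apply: is_cvg_nneseries.
  apply: nearW => m; rewrite big_mkord.
  rewrite (eq_bigr (fun i : 'I_m =>
    (iter i.+1 (@avg R d) \1_(diagonal_line d) 0)%:E)); last first.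
    by move=> i _; exact: (probability_walk _ _ d0 (hX d d0)).
  by rewrite sumEFin lee_fin sum_le.
have PE : P d E \is a fin_num by exact: fin_num_measure.
move: low high; rewrite -(fineK PE) !lee_fin; set p := fine _ => low high.
have W : (2 * d)%:R != 0 :> R by rewrite pnatr_eq0; lia.
apply/andP; split.
  by rewrite -[leLHS](mulfV W) ler_wpM2l.
apply: (@le_trans _ _ ((2 * d)%:R * ((2 * d)%:R^-1 + C * d%:R ^- 2))).
  by rewrite ler_wpM2l.
rewrite le_eqVlt; apply/orP; left; apply/eqP; rewrite natrM; field.
by [].
Unshelve. all: by end_near.
Qed.
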